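(* Let $c$ be a nonnegative integer and let $m,n$ be positive integers. Consider the linear system, for an $m\times n$ real matrix $A=[a_{ij}]$: $$0\le \sum_{l=1}^j a_{il}\ (1\le i\le m,\,1\le j\le n),\qquad 0\le\sum_{k=1}^i a_{kj}\le 1\ (1\le i\le m,\,1\le j\le n),\qquad \sum_{j=1}^n a_{ij}\le c\ (1\le i\le m).$$ Let $\mathcal{P}^c_{m,n}$ be the convex hull of all integral $m\times n$ matrices satisfying this system. Then $\mathcal{P}^c_{m,n}$ equals the set of all real $m\times n$ matrices satisfying this system.
   Context: Integral matrices satisfying the system are called $c$-SRMs; the polytope $\mathcal{P}^c_{m,n}$ is the $c$-SRM polytope. *)

(* Defs.v *)
From mathcomp Require Import all_boot all_order all_algebra.
From mathcomp Require Import boolp classical_sets reals convex.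

Set Implicit Arguments.
Unset Strict Implicit.
Unset Printing Implicit Defensive.

Import Order.TTheory GRing.Theory Num.Theory.

Local Open Scope classical_set_scope.
Local Open Scope ring_scope.

(* Indices are 0-based, so the bound [l <= j] on ordinals includes column j
   itself: the sums are over the nonempty initial segments of a row (column). *)
Definition srm_system (R : realType) (c m n : nat) (A : 'M[R]_(m, n)) : Prop :=
  [/\ forall (i : 'I_m) (j : 'I_n), 0 <= \sum_(l < n | (l <= j)%N) A i l,
      forall (i : 'I_m) (j : 'I_n), 0 <= \sum_(k < m | (k <= i)%N) A k j <= 1
    & forall i : 'I_m, \sum_(j < n) A i j <= c%:R].

Definition is_SRM (R : realType) (c m n : nat) (A : 'M[R]_(m, n)) : Prop :=
  A \is a mxOver Num.int /\ srm_system c A.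

Definition convex_hull (R : realType) (V : lmodType R) (S : set V) : set V :=
  smallest (@convex_set R V) S.

Definition srm_polytope (R : realType) (c m n : nat) : set 'M[R]_(m, n) :=
  convex_hull [set A : 'M[R]_(m, n) | is_SRM c A].

Arguments srm_polytope R c m n : clear implicits.

(* Main.v *)
Require Import Defs.
From mathcomp Require Import all_boot all_order all_algebra.
From mathcomp Require Import boolp classical_sets reals convex.
From mathcomp Require Import interval_inference lra.

(** Encode a matrix A by its corner sums f(a, b), the sum of the entries in the
    first a rows and b columns. The system then only bounds differences of two
    values of f by integers, so it survives applying to f any map of the
    form floor(x) + phi(frac(x)) with phi(0) = 0 and phi monotone with values
    in [0,1] on the fractional parts that occur.
    If t > 0 is the largest fractional part of a value of f, then
      f = (1 - t) floor(f) + t (floor(f) + frac(f) / t),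
    where both maps have this form, the first is integral, and the second has
    strictly fewer nonintegral values than f; induct on their number. *)

Import Order.TTheory GRing.Theory Num.Theory.

Local Open Scope classical_set_scope.
Local Open Scope ring_scope.

Definition frac {R : realType} (x : R) : R := x - (Num.floor x)%:~R.

Definition inflate {R : realType} (t x : R) : R :=
  (Num.floor x)%:~R + frac x / t.

(** Recovers a matrix from its corner sums. The grouping, a difference in [j] of differences in [i],
    lets row sums telescope as they stand. *)
Definition mixed_diff {R : realType} (m n : nat) (f : nat -> nat -> R) :
    'M[R]_(m, n) :=
  \matrix_(i < m, j < n) (f i.+1 j.+1 - f i j.+1 - (f i.+1 j - f i j)).

Definition corner_sum {R : realType} {m n : nat} (A : 'M[R]_(m, n))
    (a b : nat) : R :=
  \sum_(k < m | (k < a)%N) \sum_(l < n | (l < b)%N) A k l.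

(** The system read on corner sums: row prefixes, column prefixes, row totals. Each inequality has
    the shape [x <= y + k] with [k] one of 0, 1, [c]. *)
Definition potential {R : realType} (c m n : nat) (f : nat -> nat -> R) : Prop :=
  [/\ forall (i : 'I_m) (j : 'I_n), f i j.+1 <= f i.+1 j.+1,
      forall (i : 'I_m) (j : 'I_n), f i.+1 j <= f i.+1 j.+1 <= f i.+1 j + 1
    & forall i : 'I_m, f i.+1 n <= f i n + c%:R].

(** * Floors, fractional parts and inequalities with an integer shift *)

Lemma frac_ge0 {R : realType} (x : R) : 0 <= frac x.
Proof. by rewrite subr_ge0 floor_le. Qed.

Lemma frac_lt1 {R : realType} (x : R) : frac x < 1.
Proof. by rewrite ltrBlDl -[1]/(1%:~R) -intrD; case/andP: (floor_itv x). Qed.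

Lemma frac_int {R : realType} (x : R) : (x \is a Num.int) = (frac x == 0).
Proof. by rewrite intrEfloor subr_eq0 eq_sym. Qed.

Lemma floor_le_natD {R : realType} (x y : R) (k : nat) :
  x <= y + k%:R -> Num.floor x <= Num.floor y + k%:Z.
Proof.
move=> /le_floor; rewrite floorDrz ?natr_int //.
by rewrite -[k%:R]/(k%:Z%:~R) intrKfloor.
Qed.

Lemma floorR_le_natD {R : realType} (x y : R) (k : nat) :
  x <= y + k%:R -> (Num.floor x)%:~R <= (Num.floor y)%:~R + k%:R :> R.
Proof. by move=> /floor_le_natD; rewrite -(ler_int R) intrD. Qed.

(** The floors satisfy the same inequality. If it is an equality there, the fractional parts are
    ordered and scaling by [1 / t] keeps their order; otherwise the floors leave a gap of at least
    1, which absorbs [frac x / t <= 1]. *)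
Lemma inflate_le_natD {R : realType} (t x y : R) (k : nat) : 0 < t ->
  frac x <= t -> x <= y + k%:R -> inflate t x <= inflate t y + k%:R.
Proof.
move=> t0 xt xy; rewrite /inflate.
have y0 : 0 <= frac y / t by rewrite divr_ge0 ?frac_ge0 ?ltW.
have x1 : frac x / t <= 1 by rewrite ler_pdivrMr // mul1r.
have := floor_le_natD _ _ _ xy; rewrite le_eqVlt => /predU1P[e|].
  have eR : (Num.floor x)%:~R = (Num.floor y)%:~R + k%:R :> R by rewrite e intrD.
  have : frac x / t <= frac y / t.
    by rewrite ler_pM2r ?invr_gt0 // /frac eR; lra.
  lra.
by rewrite -lezD1 -(ler_int R) !intrD -[k%:Z%:~R]/(k%:R); lra.
Qed.

Lemma inflate_int {R : realType} (t x : R) :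
  x \is a Num.int -> inflate t x = x.
Proof.
move=> xi; have := xi; rewrite frac_int /inflate => /eqP ->.
by rewrite mul0r addr0 floorK.
Qed.

Lemma inflate_frac_int {R : realType} (x : R) :
  frac x != 0 -> inflate (frac x) x \is a Num.int.
Proof. by move=> x0; rewrite /inflate divff // rpredD ?intr_int ?rpred1. Qed.

Lemma floor_inflate_conv {R : realType} (t x : R) : t != 0 ->
  x = t * inflate t x + (1 - t) * (Num.floor x)%:~R.
Proof.
move=> t0; rewrite /inflate mulrDr mulrCA divff // mulr1 addrAC -mulrDl.
by rewrite [t + _]addrC subrK mul1r addrC subrK.
Qed.

(** * Corner sums and mixed differences *)

Lemma sum_ord_succ {V : zmodType} {n : nat} (F : 'I_n -> V) (i : 'I_n) :
  \sum_(k < n | (k < i.+1)%N) F k = \sum_(k < n | (k < i)%N) F k + F i.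
Proof.
rewrite (bigD1 i) //= addrC; congr (_ + _).
by apply: eq_bigl => k; rewrite ltnS [RHS]ltn_neqAle andbC.
Qed.

Lemma sum_ord_telescope {V : zmodType} {n : nat} (g : nat -> V) (a : nat) :
  (a <= n)%N -> \sum_(k < n | (k < a)%N) (g k.+1 - g k) = g a - g 0%N.
Proof.
move=> an; rewrite -(big_ord_widen n (fun k => g k.+1 - g k)) //.
by rewrite -(big_mkord xpredT (fun k => g k.+1 - g k)) telescope_sumr.
Qed.

Lemma corner_sum0l {R : realType} {m n : nat} (A : 'M[R]_(m, n)) b :
  corner_sum A 0 b = 0.
Proof. by rewrite /corner_sum big_pred0. Qed.

Lemma corner_sum0r {R : realType} {m n : nat} (A : 'M[R]_(m, n)) a :
  corner_sum A a 0 = 0.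
Proof. by rewrite /corner_sum big1 // => k _; rewrite big_pred0. Qed.

Lemma corner_sumK {R : realType} {m n : nat} (A : 'M[R]_(m, n)) :
  mixed_diff m n (corner_sum A) = A.
Proof.
apply/matrixP => i j; rewrite mxE /corner_sum !sum_ord_succ.
by have := sum_ord_succ (A i) j; lra.
Qed.

Lemma mixed_diff_row_sum {R : realType} (m n : nat) (f : nat -> nat -> R)
    (i : 'I_m) (b : nat) : (b <= n)%N -> (forall a, f a 0%N = 0) ->
  \sum_(l < n | (l < b)%N) mixed_diff m n f i l = f i.+1 b - f i b.
Proof.
move=> bn f0; under eq_bigr do rewrite mxE.
by rewrite (sum_ord_telescope (fun l => f i.+1 l - f i l)) // !f0 !subr0.
Qed.

Lemma mixed_diff_col_sum {R : realType} (m n : nat) (f : nat -> nat -> R)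
    (a : nat) (j : 'I_n) : (a <= m)%N -> (forall b, f 0%N b = 0) ->
  \sum_(k < m | (k < a)%N) mixed_diff m n f k j = f a j.+1 - f a j.
Proof.
move=> am f0.
(* The mixed difference is regrouped as a difference in [k], so that this sum telescopes too. *)
rewrite (eq_bigr (fun k : 'I_m => (f k.+1 j.+1 - f k.+1 j) - (f k j.+1 - f k j))).
  by rewrite (sum_ord_telescope (fun k => f k j.+1 - f k j)) // !f0 !subr0.
by move=> k _; rewrite mxE; lra.
Qed.

Lemma srm_system_mixed_diff {R : realType} (c m n : nat) (f : nat -> nat -> R) :
  (forall a, f a 0%N = 0) -> (forall b, f 0%N b = 0) ->
  srm_system c (mixed_diff m n f) <-> potential c m n f.
Proof.
move=> fa0 f0b.
have rowE (i : 'I_m) : \sum_(j < n) mixed_diff m n f i j = f i.+1 n - f i n.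
  rewrite -(mixed_diff_row_sum m n f i n) //.
  by apply: eq_bigl => j; rewrite ltn_ord.
have rowjE (i : 'I_m) (j : 'I_n) :
    \sum_(l < n | (l <= j)%N) mixed_diff m n f i l = f i.+1 j.+1 - f i j.+1.
  exact: (mixed_diff_row_sum m n f i j.+1).
have colE (i : 'I_m) (j : 'I_n) :
    \sum_(k < m | (k <= i)%N) mixed_diff m n f k j = f i.+1 j.+1 - f i.+1 j.
  exact: (mixed_diff_col_sum m n f i.+1 j).
split=> -[h1 h2 h3]; split=> [i j|i j|i].
- by have := h1 i j; rewrite rowjE // subr_ge0.
- by have := h2 i j; rewrite colE // subr_ge0 lerBlDl.
- by have := h3 i; rewrite rowE lerBlDl.
- by rewrite rowjE // subr_ge0.
- by rewrite colE // subr_ge0 lerBlDl.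
- by rewrite rowE lerBlDl.
Qed.

(** Serves both rounding maps: [X] holds everywhere for the floor and bounds the fractional part by
    [t] for [inflate t]. *)
Lemma potential_comp {R : realType} (c m n : nat) (f : nat -> nat -> R)
    (X : R -> Prop) (h : R -> R) :
  (forall a b, (a <= m)%N -> (b <= n)%N -> X (f a b)) ->
  (forall (x y : R) (k : nat), X x -> x <= y + k%:R -> h x <= h y + k%:R) ->
  potential c m n f -> potential c m n (fun a b => h (f a b)).
Proof.
move=> Xf hle [h1 h2 h3].
have hmono x y : X x -> x <= y -> h x <= h y.
  by move=> Xx xy; have := hle x y 0%N Xx; rewrite !addr0; apply.
split=> [i j|i j|i].
- by apply: hmono; rewrite ?h1 //; apply: Xf => //; apply: ltnW.
- have /andP[lo hi] := h2 i j; apply/andP; split.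
    by apply: hmono => //; apply: Xf => //; apply: ltnW.
  by apply: (hle _ _ 1%N) => //; apply: Xf.
- by apply: hle; rewrite ?h3 //; apply: Xf.
Qed.

Lemma mixed_diff_int {R : realType} (m n : nat) (f : nat -> nat -> R) :
  (forall a b, (a <= m)%N -> (b <= n)%N -> f a b \is a Num.int) ->
  mixed_diff m n f \is a mxOver Num.int.
Proof.
move=> fi; apply/mxOverP => i j; rewrite mxE.
by rewrite !rpredB // fi // ltnW.
Qed.

(** * Convexity and the induction *)

Lemma convex_set_conv {R : realType} {V : lmodType R} {S : set V} (t : R)
    (x y : V) : @convex_set R V S -> 0 <= t -> t <= 1 -> S x -> S y ->
  S (t *: x + (1 - t) *: y).
Proof.
move=> cS t0 t1 Sx Sy; have := cS x y (Itv01 t0 t1).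
by rewrite !in_setE; apply.
Qed.

Lemma potential_in_hull {R : realType} (c m n : nat) (S : set 'M[R]_(m, n))
    (f : nat -> nat -> R) :
  @convex_set R 'M[R]_(m, n) S -> [set A | is_SRM c A] `<=` S ->
  (forall a, f a 0%N = 0) -> (forall b, f 0%N b = 0) -> potential c m n f ->
  S (mixed_diff m n f).
Proof.
move=> cS SRM_S.
pose N (f : nat -> nat -> R) :=
  #|[pred p : 'I_m.+1 * 'I_n.+1 | f p.1 p.2 \isn't a Num.int]|.
(* Strong induction on the number of nonintegral values, for all [f] at once. *)
have [k] := ubnP (N f); elim: k f => // k IH f Nf fa0 f0b pf.
pose fr (p : 'I_m.+1 * 'I_n.+1) := frac (f p.1 p.2).
case: (@arg_maxP _ _ _ (ord0, ord0) xpredT fr) => // p _ pmax; set t := fr p.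
have fr_le a b : (a <= m)%N -> (b <= n)%N -> frac (f a b) <= t.
  move=> am bn.
  exact: (pmax (@Ordinal m.+1 a am, @Ordinal n.+1 b bn) isT).
have SRM_floor : S (mixed_diff m n (fun a b => (Num.floor (f a b))%:~R)).
  apply: SRM_S; split; first by apply: mixed_diff_int => a b _ _; rewrite intr_int.
  apply/srm_system_mixed_diff => [a|b|].
  - by rewrite fa0 floor0.
  - by rewrite f0b floor0.
  apply: (@potential_comp _ _ _ _ f xpredT (fun x => (Num.floor x)%:~R)) => //.
  by move=> x y j _; apply: floorR_le_natD.
(* If the largest fractional part is 0, then [f] agrees with its floor on the whole grid. *)
have [t0|t_neq0] := eqVneq t 0.
  suff -> : mixed_diff m n f =
    mixed_diff m n (fun a b => (Num.floor (f a b))%:~R) by [].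
  have ff a b : (a <= m)%N -> (b <= n)%N -> (Num.floor (f a b))%:~R = f a b.
    move=> am bn; apply: floorK; rewrite frac_int eq_le frac_ge0 andbT -t0.
    exact: fr_le.
  by apply/matrixP => i j; rewrite !mxE !ff // ltnW.
have t_gt0 : 0 < t by rewrite lt_neqAle eq_sym t_neq0 frac_ge0.
pose g a b := inflate t (f a b).
have infl0 : inflate t 0 = 0 by rewrite inflate_int ?rpred0.
have Sg : S (mixed_diff m n g).
  apply: IH => [|a|b|]; [|by rewrite /g fa0|by rewrite /g f0b|].
    (* Integral values stay fixed, and the value at the maximizer [p] moves up to the next integer,
       so the count drops. *)
    apply: leq_trans (_ : (N g < N f)%N) _ => //.
    apply: proper_card; apply/properP; split.
      apply/fintype.subsetP => q; rewrite !inE; apply: contraNN => fq.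
      by rewrite /g inflate_int.
    exists p; first by rewrite inE frac_int.
    by rewrite inE negbK; apply: inflate_frac_int.
  apply: (@potential_comp _ _ _ _ f (fun x => frac x <= t)) => //.
  by move=> x y j; apply: inflate_le_natD.
rewrite (_ : mixed_diff m n f = t *: mixed_diff m n g
    + (1 - t) *: mixed_diff m n (fun a b => (Num.floor (f a b))%:~R)).
  by apply: convex_set_conv => //; rewrite ltW ?frac_lt1.
apply/matrixP => i j; rewrite !mxE.
have E x := floor_inflate_conv t x t_neq0.
rewrite {1}(E (f i.+1 j.+1)) {1}(E (f i j.+1)) {1}(E (f i.+1 j)) {1}(E (f i j)).
by rewrite /g; lra.
Qed.

Lemma convex_srm_system (R : realType) (c m n : nat) :
  @convex_set R 'M[R]_(m, n) [set A | srm_system c A].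
Proof.
move=> A B l; rewrite !in_setE => -[a1 a2 a3] [b1 b2 b3].
have l0 : 0 <= l%:num by [].
have l1 : 0 <= 1 - l%:num by rewrite subr_ge0.
(* [F] lists the positions summed over, so one linearity identity covers both row and column
   sums. *)
have sumE (I : finType) (P : pred I) (F : I -> 'I_m * 'I_n) :
    \sum_(k | P k) (conv l (A : convex_lmodType _) B : 'M[R]_(m, n)) (F k).1 (F k).2 =
    l%:num * (\sum_(k | P k) A (F k).1 (F k).2)
    + (1 - l%:num) * (\sum_(k | P k) B (F k).1 (F k).2).
  by rewrite !mulr_sumr -big_split; apply: eq_bigr => k _; rewrite !mxE.
split=> [i j|i j|i].
- rewrite (sumE _ _ (fun l => (i, l))) /=.
  by rewrite addr_ge0 ?mulr_ge0.
- rewrite (sumE _ _ (fun k => (k, j))) /=.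
  have /andP[A0 A1] := a2 i j; have /andP[B0 B1] := b2 i j.
  rewrite addr_ge0 ?mulr_ge0 //=.
  by have := ler_wpM2l l0 A1; have := ler_wpM2l l1 B1; lra.
- rewrite (sumE _ _ (fun j => (i, j))) /=.
  by have := ler_wpM2l l0 (a3 i); have := ler_wpM2l l1 (b3 i); lra.
Qed.

Theorem theorem5p4 (R : realType) (c m n : nat)
    (m_gt0 : (0 < m)%N) (n_gt0 : (0 < n)%N) :
  srm_polytope R c m n = [set A : 'M[R]_(m, n) | srm_system c A].
Proof.
apply/seteqP; split=> A.
  by apply; split=> [|B []//]; apply: convex_srm_system.
(* Membership in the hull is tested on an arbitrary convex [S] containing the SRMs. *)
move=> sA S [cS SRM_S]; rewrite -(corner_sumK A).
have [A0r A0l] := (corner_sum0r A, corner_sum0l A).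
apply: (@potential_in_hull R c) => //.
by apply/srm_system_mixed_diff; rewrite ?corner_sumK.
Qed.
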